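(* Let $(X,d_X)$ and $(Y,d_Y)$ be nonempty semimetric spaces, let $f:D(Y)\to D(X)$ be an increasing bijection and let $t\in D(Y)$. Then $f$ is continuous at $t$ and $f^{-1}$ is continuous at $f(t)$ if and only if both $$t\in\mathrm{ac}([t,\infty)\cap D(Y))\ \Leftrightarrow\ f(t)\in\mathrm{ac}([f(t),\infty)\cap D(X))$$ and $$t\in\mathrm{ac}([0,t]\cap D(Y))\ \Leftrightarrow\ f(t)\in\mathrm{ac}([0,f(t)]\cap D(X))$$ hold.
   Context: A semimetric on a set $X$ is a function $d:X\times X\to[0,\infty)$ with $d(x,y)=d(y,x)$ and $(d(x,y)=0\Leftrightarrow x=y)$ for all $x,y\in X$; $(X,d)$ is then a semimetric space. The distance set of a nonempty semimetric space is $D(X)=\{d(x,y):x,y\in X\}\subseteq[0,\infty)$, considered with the order and topology induced from $\mathbb R$. For $A\subseteq[0,\infty)$, $\mathrm{ac}(A)$ is the set of all accumulation points of $A$ in $[0,\infty)$ with the standard topology. *)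

(* Defs.v *)
From HB Require Import structures.
From mathcomp Require Import all_boot all_order all_algebra.
From mathcomp Require Import all_classical all_reals all_analysis.

Set Implicit Arguments.
Unset Strict Implicit.
Unset Printing Implicit Defensive.

Import Order.TTheory GRing.Theory Num.Theory.
Import numFieldNormedType.Exports.

Local Open Scope classical_set_scope.
Local Open Scope ring_scope.

Definition semimetric (R : realType) (X : Type) (d : X -> X -> R) : Prop :=
  [/\ forall x y, 0 <= d x y,
      forall x y, d x y = d y x &
      forall x y, d x y = 0 <-> x = y].

(* Used as a type, [distset d] is the subtype of its members, which carries the
   topology induced from [R]. *)
Definition distset (R : realType) (X : Type) (d : X -> X -> R) : set R :=
  [set r | exists x y, d x y = r].

Definition nonneg_reals (R : realType) : set R := `[0, +oo[.
Arguments nonneg_reals R : clear implicits.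

(* The limit points are taken in the space [0, +oo[ with its induced topology,
   and then viewed in [R]. *)
Definition ac (R : realType) (A : set R) : set R :=
  [set val x | x in limit_point [set y : nonneg_reals R | A (val y)]].

(* Main.v *)
(** Continuity of [f] at [t] splits into the two one-sided conditions.  If [t] is
    isolated in [D(Y)] on one side there is nothing to check on that side.
    Otherwise [f t] is an accumulation point of [D(X)] on the same side, so there
    is [u] in [D(X)] on that side within [e] of [f t], and monotonicity puts
    [f r] between [f t] and [u] for all [r] between [t] and [finv u].
    Conversely, a strictly increasing map continuous at [t] carries points of
    [D(Y)] approaching [t] from one side to points of [D(X)] approaching [f t]
    from the same side.  Both arguments apply to [finv] as well. *)
Require Import Defs.
From mathcomp Require Import all_boot all_order all_algebra.
From mathcomp Require Import all_classical all_reals all_analysis.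
From mathcomp Require Import lra.
Import Order.TTheory GRing.Theory Num.Theory.
Import numFieldNormedType.Exports.
Local Open Scope classical_set_scope.
Local Open Scope ring_scope.

Set Implicit Arguments.
Unset Strict Implicit.

(** The topology on the type [A] is initial for [val]: its open sets are preimages of open sets of
    [R], so preimages of balls around [val t] suffice. *)
Lemma nbhs_set_typeP (R : realType) (A : set R) (t : A) (U : set A) :
  nbhs t U <->
  exists2 e : R, 0 < e & forall r : A, `|val r - val t| < e -> U r.
Proof.
split=> [[V [[W oW WV] Vt VU]]|[e e0 eU]].
  have Wt : W (val t) by move: Vt; rewrite -WV.
  have [e /= e0 eW] := (nbhs_ballP _ _).1 (open_nbhs_nbhs (conj oW Wt)).
  exists e => // r rt; apply: VU; rewrite -WV; apply: eW.
  by rewrite /ball /= distrC.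
exists (val @^-1` (ball (val t) e)); split.
- by exists (ball (val t) e) => //; exact: ball_open.
- exact: ballxx.
- by move=> r rt; apply: eU; rewrite distrC.
Qed.

Lemma continuous_set_typeP (R : realType) (A B : set R) (f : A -> B) (t : A) :
  {for t, continuous f} <->
  forall e : R, 0 < e -> exists2 d : R, 0 < d &
    forall r : A, `|val r - val t| < d -> `|val (f r) - val (f t)| < e.
Proof.
split=> [ft e e0|ft U /nbhs_set_typeP[e e0 eU]].
  apply/nbhs_set_typeP/(ft [set y | `|val y - val (f t)| < e]).
  by apply/nbhs_set_typeP; exists e.
have [d d0 dP] := ft e e0.
by apply/nbhs_set_typeP; exists d => // r /dP /eU.
Qed.

(** The two inclusions let [x] and the points of [A] be lifted to the subtype in which [ac] takes
    limit points. *)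
Lemma acP (R : realType) (A : set R) (x : R) :
  A `<=` nonneg_reals R -> nonneg_reals R x ->
  ac A x <->
  forall e : R, 0 < e -> exists2 y, A y & 0 < `|y - x| < e.
Proof.
move=> A0 x0; split=> [[z zA <-] e e0|xA].
  have [|y [yz yA yze]] := zA [set y | `|val y - val z| < e].
    by apply/nbhs_set_typeP; exists e.
  by exists (val y) => //; rewrite normr_gt0 subr_eq0 (inj_eq val_inj) yz.
exists (SigSub (mem_set x0)) => // U /nbhs_set_typeP[e e0 eU].
have [y yA /andP[yx yxe]] := xA e e0.
exists (SigSub (mem_set (A0 _ yA))); split => //; last exact: eU.
by rewrite -(inj_eq val_inj) -subr_eq0 -normr_gt0.
Qed.

(* [b = false] is accumulation from the right, [b = true] from the left. *)
Definition onesided_acc (R : realType) (A : set R) (b : bool) (t : A) : Prop :=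
  forall e : R, 0 < e -> exists r : A, 0 < (-1) ^+ b * (val r - val t) < e.

(** On [I] the signed difference is nonnegative, hence equal to the distance to [t]. This treats
    both sides at once. *)
Lemma ac_onesidedP (R : realType) (A : set R) (b : bool) (t : A) (I : set R) :
  A `<=` nonneg_reals R ->
  (forall r : A, I (val r) <-> 0 <= (-1) ^+ b * (val r - val t)) ->
  ac (I `&` A) (val t) <-> onesided_acc b t.
Proof.
move=> A0 Ib; rewrite acP; first last.
- exact/A0/set_valP.
- by move=> r [_ /A0].
split=> tA e e0; have := tA e e0.
  case=> y [Iy Ay] yt; exists (SigSub (mem_set Ay)) => /=.
  have /Ib /= yt0 : I (val (SigSub (mem_set Ay) : A)) by [].
  by rewrite -(ger0_norm yt0) normrMsign.
case=> r /andP[rt rte]; exists (val r).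
  by split; [apply/Ib/ltW|exact: set_valP].
by rewrite -(normrMsign b) gtr0_norm// rt.
Qed.

Lemma ac_rightP (R : realType) (A : set R) (t : A) :
  A `<=` nonneg_reals R ->
  ac (`[val t, +oo[ `&` A) (val t) <-> onesided_acc false t.
Proof.
move=> A0; apply: ac_onesidedP => // r.
by rewrite /= in_itv /= andbT expr0 mul1r subr_ge0.
Qed.

Lemma ac_leftP (R : realType) (A : set R) (t : A) :
  A `<=` nonneg_reals R ->
  ac (`[0, val t] `&` A) (val t) <-> onesided_acc true t.
Proof.
move=> A0; apply: ac_onesidedP => // r.
(* The lower end [0] of the interval imposes nothing on points of [A]. *)
have := A0 _ (set_valP r).
rewrite /nonneg_reals /= !in_itv /= andbT => -> /=.
by rewrite expr1 mulN1r opprB subr_ge0.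
Qed.

Lemma homo_lt_sign (R : realType) (A B : set R) (f : A -> B) (b : bool)
  (r s : A) :
  {homo f : r s / val r < val s} ->
  0 < (-1) ^+ b * (val s - val r) -> 0 < (-1) ^+ b * (val (f s) - val (f r)).
Proof.
move=> f_incr; case: b; rewrite ?expr1 ?expr0 ?mulN1r ?mul1r ?opprB !subr_gt0;
  exact: f_incr.
Qed.

(** The order is total, so a failure would mean [g s <= g r], and applying [f] would give
    [s <= r]. *)
Lemma homo_lt_cancel (R : realType) (A B : set R) (f : A -> B) (g : B -> A) :
  cancel g f -> {homo f : r s / val r < val s} ->
  {homo g : r s / val r < val s}.
Proof.
move=> gK f_incr r s rs; rewrite ltNge; apply/negP; rewrite le_eqVlt.
move=> /orP[/eqP/val_inj/(congr1 f)|/f_incr]; rewrite !gK.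
  by move=> sr; rewrite sr ltxx in rs.
by move=> /(lt_trans rs); rewrite ltxx.
Qed.

Lemma continuous_onesided_acc (R : realType) (A B : set R) (f : A -> B)
  (b : bool) (t : A) :
  {homo f : r s / val r < val s} -> {for t, continuous f} ->
  onesided_acc b t -> onesided_acc b (f t).
Proof.
move=> f_incr /continuous_set_typeP ft tA e /ft[d d0 dP].
have [r /andP[rt rtd]] := tA d d0; exists (f r).
have frt := homo_lt_sign f_incr rt; rewrite frt /=.
rewrite -(gtr0_norm frt) normrMsign; apply: dP.
by rewrite -(normrMsign b) gtr0_norm.
Qed.

Lemma onesided_acc_continuous (R : realType) (A B : set R) (f : A -> B)
  (g : B -> A) (t : A) :
  cancel f g -> cancel g f -> {homo f : r s / val r < val s} ->
  (forall b, onesided_acc b t -> onesided_acc b (f t)) ->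
  {for t, continuous f}.
Proof.
move=> fK gK f_incr tacc; apply/continuous_set_typeP => e e0.
have g_incr := homo_lt_cancel gK f_incr.
have side (b : bool) : exists2 d : R, 0 < d & forall r : A,
    0 < (-1) ^+ b * (val r - val t) < d -> `|val (f r) - val (f t)| < e.
  have [/tacc/(_ e e0)[u /andP[u0 ue]]|] := pselect (onesided_acc b t).
    have := homo_lt_sign g_incr u0; rewrite fK => gu0.
    (* With this radius, [r] lies strictly between [t] and [g u], so [f r] lies strictly between
       [f t] and [u]. *)
    exists ((-1) ^+ b * (val (g u) - val t)) => // r /andP[rt rgu].
    have rgu0 : 0 < (-1) ^+ b * (val (g u) - val r) by lra.
    have := homo_lt_sign f_incr rgu0; rewrite gK => fru.
    rewrite -(normrMsign b) gtr0_norm; last exact: homo_lt_sign.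
    lra.
  (* No point of [A] lies within [d] of [t] on side [b], so the bound holds vacuously. *)
  move=> /existsNP[d /not_implyP[d0 tNacc]]; exists d => // r rt.
  by exfalso; apply: tNacc; exists r.
have [[d d0 dP] [d' d'0 d'P]] := (side false, side true).
exists (Num.min d d') => [|r]; first by rewrite lt_min d0.
rewrite lt_min => /andP[rd rd'].
have [rt|tr|/val_inj ->] := ltgtP (val r) (val t); last by rewrite subrr normr0.
  apply: d'P; rewrite expr1 mulN1r opprB subr_gt0 rt /=.
  by rewrite ltr0_norm ?subr_lt0// opprB in rd'.
apply: dP; rewrite expr0 mul1r subr_gt0 tr /=.
by rewrite gtr0_norm ?subr_gt0// in rd.
Qed.

Lemma distset_nonneg (R : realType) (X : Type) (d : X -> X -> R) :
  semimetric d -> distset d `<=` nonneg_reals R.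
Proof.
by move=> [d_ge0 _ _] _ [x [y <-]]; rewrite /nonneg_reals /= in_itv /= d_ge0.
Qed.

Unset Implicit Arguments.
Set Strict Implicit.

Theorem proposition2p2 (R : realType) (X Y : Type)
  (dX : X -> X -> R) (dY : Y -> Y -> R)
  (X_neq0 : inhabited X) (Y_neq0 : inhabited Y)
  (semiX : semimetric dX) (semiY : semimetric dY)
  (f : distset dY -> distset dX) (finv : distset dX -> distset dY)
  (fK : cancel f finv) (finvK : cancel finv f)
  (f_incr : {homo f : r s / val r < val s})
  (t : distset dY) :
  ({for t, continuous f} /\ {for f t, continuous finv}) <->
  ((ac (`[val t, +oo[ `&` distset dY) (val t) <->
    ac (`[val (f t), +oo[ `&` distset dX) (val (f t))) /\
   (ac (`[0, val t] `&` distset dY) (val t) <->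
    ac (`[0, val (f t)] `&` distset dX) (val (f t)))).
Proof.
have Y0 := distset_nonneg semiY; have X0 := distset_nonneg semiX.
rewrite !ac_rightP// !ac_leftP//.
have finv_incr := homo_lt_cancel finvK f_incr.
split=> [[ft finvt]|[accr accl]].
  have acc b : onesided_acc b t <-> onesided_acc b (f t).
    split; first exact: continuous_onesided_acc.
    (* Writing [t] as [finv (f t)] turns the converse into the same lemma for [finv] at [f t]. *)
    by rewrite -{2}(fK t); exact: continuous_onesided_acc.
  by split.
have acc b : onesided_acc b t <-> onesided_acc b (f t) by case: b.
split; first by apply: (onesided_acc_continuous fK) => // b /acc.
apply: (onesided_acc_continuous finvK) => // b; rewrite fK.
by move=> /acc.
Qed.
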